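(* Let $\{X_j\}$ be a (strictly) stationary, $\alpha$-mixing sequence of real random variables with marginal distribution function $F(x)=\mathbb{P}(X_1\le x)$, which is continuous at $F_*=\sup\{x:F(x)<1\}$. Then $\{X_j\}$ admits a continuous phantom distribution function provided that one of the following holds: (i) $\{X_j\}$ is $m$-dependent for some $m$ (i.e. $\alpha(m+1)=0$) and $F$ satisfies Condition $\Delta_0$; (ii) for some constants $C>0$ and $\rho\in[0,1)$ we have $\alpha(n)\le C\rho^n$ for all $n$, and $F$ satisfies Condition $\Delta_\xi$ for some $\xi>0$; (iii) for some constants $C>0$ and $\beta>0$ we have $\alpha(n)\le C n^{-\beta}$ for all $n$, and $F$ satisfies Condition $\Delta_\xi$ for some $\xi>1/\beta$.
   Context: $M_n=\max_{1\le j\le n}X_j$. A distribution function $G$ is a phantom distribution function for the stationary sequence $\{X_j\}$ if $\sup_{u\in\mathbb{R}}|\mathbb{P}(M_n\le u)-G^n(u)|\to 0$ as $n\to\infty$, where $G^n(u)=(G(u))^n$. Let $\Delta F(x)=F(x)-F(x-)$. Condition $\Delta_0$: $\displaystyle\lim_{x\to F_*-}\frac{\Delta F(x)}{1-F(x)}=0$. Condition $\Delta_\xi$ (for $\xi>0$): $\displaystyle\sup_{x<F_*}\frac{\Delta F(x)}{(1-F(x))^{1+\xi}}<+\infty$. Continuity of $F$ at $F_*$ means $F(F_*-)=1$ (automatic if $F_*=+\infty$). For $s\in\mathbb{N}$ let $\mathcal{M}^s$ be the family of all measurable non-constant functions $f:\mathbb{R}^s\to\mathbb{R}$ with $\sup|f|\le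 1$. The $\alpha$-mixing coefficient is $$\alpha(r)=\sup\frac{\left|\mathrm{Cov}\left(f(X_{i_1},\dots,X_{i_s}),g(X_{j_1},\dots,X_{j_t})\right)\right|}{4},$$ the supremum being over all $s,t\in\mathbb{N}$, $f\in\mathcal{M}^s$, $g\in\mathcal{M}^t$ and all indices $i_1\le\cdots\le i_s\le j_1\le\cdots\le j_t$ with $j_1-i_s\ge r$. The sequence is $\alpha$-mixing if $\alpha(r)\to 0$ as $r\to\infty$. *)

(* Defs.v *)
From HB Require Import structures.
From mathcomp Require Import all_boot all_order all_algebra.
From mathcomp Require Import all_classical all_reals all_analysis.

Set Implicit Arguments.
Unset Strict Implicit.
Unset Printing Implicit Defensive.

Import Order.TTheory GRing.Theory Num.Theory.
Import numFieldNormedType.Exports.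

Local Open Scope classical_set_scope.
Local Open Scope ring_scope.

(* A sequence {X_j}_{j >= 1} is represented by X : nat -> {RV P >-> R}, where
   X i stands for the variable of index i + 1: the first variable is X 0, and
   M_n is the maximum of X 0, ..., X n.-1. *)

Section random_sequence.
Context d (T : measurableType d) (R : realType) (P : probability T R).
Variable X : nat -> {RV P >-> R}.

Definition subvector n (j : n.-tuple nat) (w : T) : n.-tuple R :=
  [tuple X (tnth j k) w | k < n].

Definition stationary : Prop :=
  forall (n h : nat) (j : n.-tuple nat) (A : set (n.-tuple R)), measurable A ->
    P (subvector [tuple (tnth j k + h)%N | k < n] @^-1` A)
    = P (subvector j @^-1` A).

(* For n >= 1 the default value X 0 is one of the terms; the junk value at
   n = 0 is not used. *)
Definition running_max (n : nat) (w : T) : R :=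
  \big[Num.max/X 0%N w]_(i < n) X i w.

Definition phantom_df (G : R -> R) : Prop :=
  ereal_sup [set `|P [set w | (running_max n w <= u)%R] - (G u ^+ n)%:E|%E
            | u in [set: R]] @[n --> \oo] --> 0%E.

Definition marginal_df (x : R) : R := fine (cdf (X 0%N) x).

Definition test_function s (f : s.-tuple R -> R) : Prop :=
  [/\ measurable_fun [set: s.-tuple R] f,
      forall x, `|f x| <= 1 &
      exists x y, f x != f y].

(* The numbers of arguments, which are at least 1, are s.+1 and t.+1. *)
Definition alpha_coef (r : nat) : \bar R :=
  ereal_sup [set c : \bar R |
    exists s t (i : s.+1.-tuple nat) (j : t.+1.-tuple nat)
           (f : s.+1.-tuple R -> R) (g : t.+1.-tuple R -> R),
      [/\ sorted leq i, sorted leq j,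
          (tnth i ord_max + r <= tnth j ord0)%N,
          test_function f /\ test_function g &
          c = (`|covariance P (f \o subvector i) (g \o subvector j)|
               * (4^-1)%:E)%E]].

Definition alpha_mixing : Prop := alpha_coef r @[r --> \oo] --> 0%E.

End random_sequence.

Section distribution_function.
Context (R : realType) (F : R -> R).

Definition right_end : \bar R := ereal_sup [set x%:E | x in [set x | F x < 1]].

Definition jump (x : R) : R := F x - lim (F y @[y --> x^'-]).

(* The real numbers tending to a from below; for a = -oo there are none. *)
Definition ereal_at_left (a : \bar R) : set_system R :=
  match a with
  | r%:E => r^'-
  | +oo => pinfty_nbhs R
  | -oo => [set: set R]
  end%E.

Definition continuous_at_right_end : Prop :=
  F x @[x --> ereal_at_left right_end] --> (1 : R).

Definition condition_Delta0 : Prop :=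
  jump x / (1 - F x) @[x --> ereal_at_left right_end] --> (0 : R).

Definition condition_Delta (xi : R) : Prop :=
  (ereal_sup [set (jump x / (1 - F x) `^ (1 + xi))%:E
             | x in [set x | x%:E < right_end]] < +oo)%E.

End distribution_function.

(* Main.v *)
(* Write H_n(x) = P(M_n <= x).  Mixing gives H_{p+q}(x) = H_p(x) H_q(x) up to an
   error that is uniform in p and q and vanishes as F(x) -> 1: the maximum over
   a gap of fixed length between the two blocks costs at most a multiple of
   1 - F(x).  Let N(x) be the least n with H_n(x) < 1/e.  Since
   H_{n-1} - H_n <= 1 - F, H_{N(x)}(x) is close to 1/e near the right end, and
   approximate multiplicativity forces H_n(x) to be close to exp(-n / N(x))
   uniformly in n.  Thus the step function exp(-1 / N(x)), which jumps at the
   levels v_k = inf {x | H_k(x) >= 1/e}, is a phantom distribution function.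
   To make it continuous, each jump at v_k is replaced by a linear ramp between
   the preceding distinct level and v_k.  This is harmless as soon as
   v_j = v_k with j <= k forces j/k -> 1, which holds if n (F(x) - F(x-)) -> 0
   uniformly over the x with H_n(x) >= 1/e.  That last property is where the
   conditions on the jumps of F enter, through the bound
   H_n(x) <= F(x)^s + 4 s alpha(r), r s <= n: it gives n (1 - F(x)) = O(r) as
   soon as (n / r) alpha(r) is small; r is constant under m-dependence and of
   the form n^theta, 1 / (1 + beta) < theta < xi / (1 + xi), under (iii).
   Case (ii) is a special case of (iii). *)

Require Import Defs.
From HB Require Import structures.
From mathcomp Require Import all_boot all_order all_algebra.
From mathcomp Require Import all_classical all_reals all_analysis.
From mathcomp Require Import measurable_realfun.
From mathcomp Require Import ring lra zify.

Set Implicit Arguments.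
Unset Strict Implicit.
Unset Printing Implicit Defensive.

Import Order.TTheory GRing.Theory Num.Theory.
Import numFieldNormedType.Exports.

Local Open Scope classical_set_scope.
Local Open Scope ring_scope.

(** * Approximately multiplicative sequences *)

Section approximately_multiplicative.
Context (R : archiRealFieldType).
Implicit Types (f g : nat -> R) (e : R).

Definition approx_mul e f : Prop :=
  [/\ f 0%N = 1, forall n, 0 <= f n <= 1,
      forall n m, (n <= m)%N -> f m <= f n &
      forall p q, `|f (p + q)%N - f p * f q| <= e].

(** Each factor costs [e], damped by [f m <= 1]. The linear growth is harmless: [b] is fixed in the
    applications while [m] is arbitrary. *)
Lemma approx_mul_pow e f b m : approx_mul e f ->
  `|f (b * m)%N - f m ^+ b| <= b%:R * e.
Proof.
move=> [f0 f01 _ fM]; elim: b => [|b IH].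
  by rewrite mul0n f0 expr0 subrr normr0 mul0r.
have := fM m (b * m)%N; rewrite mulSn => h; have /andP[m0 m1] := f01 m.
have : `|f m * (f (b * m)%N - f m ^+ b)| <= b%:R * e.
  by rewrite normrM ger0_norm//; apply: le_trans IH; exact: ler_piMl.
move: h; rewrite !ler_norml mulrBr -exprS -natr1; lra.
Qed.

(* Since [f N] is bounded away from 1, the errors form a geometric series. *)
Lemma approx_mul_pow_unif e f N j : approx_mul e f -> f N <= 3 / 4 ->
  `|f (j * N)%N - f N ^+ j| <= 4 * e.
Proof.
move=> [f0 f01 _ fM] fN.
have e0 : 0 <= e by apply: le_trans (fM 0%N 0%N).
elim: j => [|j IH].
  by rewrite mul0n f0 expr0 subrr normr0 mulr_ge0.
have := fM N (j * N)%N; rewrite mulSn => h; have /andP[m0 m1] := f01 N.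
have : `|f N * (f (j * N)%N - f N ^+ j)| <= 3 / 4 * (4 * e).
  by rewrite normrM ger0_norm//; exact: ler_pM.
move: h; rewrite !ler_norml mulrBr -exprS; lra.
Qed.

(** Again a geometric series: with bases at most 3/4 the errors add up to at most [e / (1 - 3/4)],
    whatever [n] is. *)
Lemma exprn_perturb (x y e : R) n : 0 <= x <= 3 / 4 -> 0 <= y <= 3 / 4 ->
  x <= y + e -> 0 <= e -> x ^+ n <= y ^+ n + 4 * e.
Proof.
move=> /andP[x0 x1] /andP[y0 y1] xy e0; elim: n => [|n IH].
  by rewrite !expr0 lerDl mulr_ge0.
have yn : y ^+ n <= 1 by apply: exprn_ile1 => //; lra.
have yn0 : 0 <= y ^+ n by rewrite exprn_ge0.
have h1 : x * x ^+ n <= x * (y ^+ n + 4 * e) by exact: ler_wpM2l.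
have h2 : x * y ^+ n <= (y + e) * y ^+ n by exact: ler_wpM2r.
have h3 : e * y ^+ n <= e by rewrite ler_piMr.
have h4 : x * (4 * e) <= 3 / 4 * (4 * e) by rewrite ler_wpM2r// mulr_ge0.
rewrite !exprS; lra.
Qed.

Lemma exprn_superadditive (x y : R) n : 0 <= x -> 0 <= y -> (0 < n)%N ->
  x ^+ n + y ^+ n <= (x + y) ^+ n.
Proof.
move=> x0 y0; case: n => // n _; elim: n => [|n IH]; first by rewrite !expr1.
have xn : 0 <= x ^+ n.+1 by rewrite exprn_ge0.
have yn : 0 <= y ^+ n.+1 by rewrite exprn_ge0.
have := ler_wpM2l (addr_ge0 x0 y0) IH.
have := mulr_ge0 x0 yn; have := mulr_ge0 y0 xn.
by rewrite -exprS !(exprS _ n.+1); lra.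
Qed.

Lemma bernoulli_exprn (x : R) n : 0 <= x -> 1 + n%:R * x <= (1 + x) ^+ n.
Proof.
move=> x0; elim: n => [|n IH]; first by rewrite mul0r addr0.
have h : 0 <= n%:R * x * x by rewrite !mulr_ge0.
have := ler_wpM2l (addr_ge0 ler01 x0) IH; rewrite -exprS -natr1; lra.
Qed.

(* [f m ^ b] is compared with [f N ^ a], where [a N <= b m < (a + 1) N]; taking
   the b-th power turns the bounded loss factor [1 / f N] into one close to 1. *)
Lemma approx_mul_le e f g N b (t : R) m :
  approx_mul e f -> approx_mul e g -> (0 < N)%N -> (0 < b)%N -> 0 < t ->
  8 <= b%:R * t -> (9 * b%:R + 68) * e < t ^+ b ->
  8^-1 <= f N -> f N <= 3 / 4 -> g N <= 3 / 4 -> f N <= g N + e ->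
  f m <= g m + 2 * t.
Proof.
move=> af ag N0 b0 t0 bt eb f8 fN gN fg.
have [_ f01 fd fM] := af; have [_ g01 gd _] := ag.
have e0 : 0 <= e by apply: le_trans (fM 0%N 0%N).
pose a := (b * m %/ N)%N.
have aN : (a * N <= b * m)%N by exact: leq_divM.
have bN : (b * m <= a.+1 * N)%N by apply: ltnW; rewrite ltn_ceil.
rewrite leNgt; apply/negP => fgm.
have /andP[gm0 gm1] := g01 m; have /andP[gN0 _] := g01 N.
have := approx_mul_pow b m af; have := approx_mul_pow b m ag.
have := approx_mul_pow_unif a af fN; have := approx_mul_pow_unif a.+1 ag gN.
have := fd _ _ aN; have := gd _ _ bN.
have : f N ^+ a <= 8 * f N ^+ a.+1.
  have fNa : 0 <= f N ^+ a by rewrite exprn_ge0//; lra.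
  by have := ler_wpM2r fNa f8; rewrite exprS; lra.
have : f N ^+ a.+1 <= g N ^+ a.+1 + 4 * e by apply: exprn_perturb => //; lra.
(* As [g m <= 1], the assumption gives [f m > (1 + t) g m + t]. Superadditivity splits the power,
   and Bernoulli with [b t >= 8] makes [(1 + t) ^ b] exceed the loss factor 8. *)
have : 8 * g m ^+ b + t ^+ b <= f m ^+ b.
  have h1 : 8 * g m ^+ b <= ((1 + t) * g m) ^+ b.
    rewrite exprMn ler_wpM2r ?exprn_ge0//.
    by have := bernoulli_exprn b (ltW t0); lra.
  apply: (@le_trans _ _ (((1 + t) * g m) ^+ b + t ^+ b)); first by rewrite lerD2r.
  have h2 : 0 <= (1 + t) * g m by rewrite mulr_ge0//; lra.
  apply: (le_trans (exprn_superadditive h2 (ltW t0) b0)).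
  rewrite lerXn2r ?nnegrE//; [by lra| by lra|].
  by have := ler_piMr (ltW t0) gm1; lra.
(* Following [f m ^ b], [f (b m)], [f N ^ a], [8 f N ^ (a + 1)], [8 g N ^ (a + 1)], [8 g (b m)],
   [8 g m ^ b], the errors are [b e], [4 e], [32 e], [32 e] and [8 b e], in total
   [(9 b + 68) e < t ^ b]: a contradiction. *)
rewrite !ler_norml; lra.
Qed.

(** Agreement at one index, where the values stay away from 0 and 1, spreads to all indices, with a
    tolerance that depends on [t] alone. The one-sided comparison is applied in both directions with
    [t / 2]; the extra halving in the witness makes its smallness condition strict. *)
Lemma approx_mul_close (t : R) : 0 < t -> exists e0 : R, 0 < e0 /\
  forall e f g N, e <= e0 -> approx_mul e f -> approx_mul e g -> (0 < N)%N ->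
    8^-1 <= f N <= 3 / 4 -> 8^-1 <= g N <= 3 / 4 -> `|f N - g N| <= e ->
    forall m, `|f m - g m| <= t.
Proof.
move=> t0; pose s := t / 2; have s0 : 0 < s by rewrite divr_gt0.
pose b := (Num.truncn (8 / s)).+1.
have bs : 8 <= b%:R * s by rewrite -ler_pdivrMr// ltW// truncnS_gt.
have c0 : 0 < 9 * b%:R + 68 :> R by rewrite ltr_wpDl// mulr_ge0.
have sb0 : 0 < s ^+ b by rewrite exprn_gt0.
exists (s ^+ b / 2 / (9 * b%:R + 68)); split; first by rewrite !divr_gt0.
move=> e f g N; rewrite ler_pdivlMr// mulrC => eb af ag N0 /andP[f8 fN] /andP[g8 gN].
rewrite ler_norml => /andP[fg gf] m.
have h1 : f m <= g m + 2 * s.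
  by apply: (@approx_mul_le e _ _ N b) => //; [lra|lra].
have h2 : g m <= f m + 2 * s.
  by apply: (@approx_mul_le e _ _ N b) => //; [lra|lra].
rewrite ler_norml; move: h1 h2; rewrite /s; lra.
Qed.

End approximately_multiplicative.

(** * Mixtures of uniform distributions *)

Section mixture.
Context (R : realType).
Variables (w a v : nat -> R) (m : R).
Hypothesis w0 : w 0%N = 0.
Hypothesis w_homo : forall i j, (i <= j)%N -> w i <= w j.
Hypothesis w_cvg : w n @[n --> \oo] --> (1 : R).
Hypothesis av : forall k, a k < v k.
Hypothesis ma : forall k, m <= a k.

Definition ramp k (x : R) : R := Num.min 1 (Num.max 0 ((x - a k) / (v k - a k))).

Definition mixture_sum n (x : R) : R := \sum_(0 <= k < n) (w k.+1 - w k) * ramp k x.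

(** Component [k] has mass [w k.+1 - w k]; the masses sum to 1 because [w] goes from 0 to 1. *)
Definition mixture (x : R) : R := limn (mixture_sum ^~ x).

Lemma ramp_ge0 k x : 0 <= ramp k x.
Proof. by rewrite le_min ler01 le_max lexx. Qed.

Lemma ramp_le1 k x : ramp k x <= 1.
Proof. by rewrite ge_min lexx. Qed.

Lemma ramp_homo k : {homo ramp k : x y / x <= y}.
Proof.
move=> x y xy; rewrite /ramp le_min2// le_max2//.
by rewrite ler_pM2r ?invr_gt0 ?subr_gt0// lerD2r.
Qed.

Lemma continuous_ramp k : continuous (ramp k).
Proof.
move=> x; apply: (@continuous_min _ _ (cst 1)
  (fun x => Num.max 0 ((x - a k) / (v k - a k)))).
  exact: cvg_cst.
apply: (@continuous_max _ _ (cst 0) (fun x => (x - a k) / (v k - a k))).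
  exact: cvg_cst.
by apply: cvgMr_tmp; apply: cvgB => //; exact: cvg_cst.
Qed.

Lemma ramp_eq1 k x : v k <= x -> ramp k x = 1.
Proof.
move=> vx; apply/min_idPl; rewrite le_max ler_pdivlMr ?subr_gt0// mul1r lerD2r vx orbT//.
Qed.

Lemma ramp_eq0 k x : x <= a k -> ramp k x = 0.
Proof.
move=> xa; rewrite /ramp (max_idPl _) ?(min_idPr _)//.
by rewrite ler_pdivrMr ?subr_gt0// mul0r subr_le0.
Qed.

Lemma w_le1 n : w n <= 1.
Proof.
rewrite -(cvg_lim _ w_cvg)//; apply: nondecreasing_cvgn_le; last by apply/cvg_ex; exists 1.
by move=> i j; exact: w_homo.
Qed.

Lemma mixture_sum_le n p x : (n <= p)%N ->
  mixture_sum n x <= mixture_sum p x <= mixture_sum n x + (w p - w n).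
Proof.
move=> np; rewrite /mixture_sum (big_cat_nat (leq0n n) np)//=; apply/andP; split.
  rewrite lerDl sumr_ge0// => k _; rewrite mulr_ge0 ?ramp_ge0// subr_ge0 w_homo//.
rewrite lerD2l -telescope_sumr//; apply: ler_sum => k _.
by rewrite ler_piMr ?ramp_le1// subr_ge0 w_homo.
Qed.

(** The components from [n] on have total mass at most [1 - w n], uniformly in [x]. Through this
    estimate monotonicity, continuity and the limits are all reduced to finite sums. *)
Lemma mixture_bounds n x : mixture_sum n x <= mixture x <= mixture_sum n x + (1 - w n).
Proof.
have mono : nondecreasing_seq (mixture_sum ^~ x).
  by move=> i j ij; have /andP[] := mixture_sum_le x ij.
have cv : cvgn (mixture_sum ^~ x).
  apply: nondecreasing_is_cvgn => //; exists 1 => _ [k _ <-].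
  have /andP[_] := mixture_sum_le x (leq0n k).
  rewrite {2}/mixture_sum big_geq// add0r w0 subr0 => /le_trans; apply; exact: w_le1.
apply/andP; split; first exact: nondecreasing_cvgn_le.
apply: limr_le => //; exists n => // k /= nk.
have /andP[_ /le_trans] := mixture_sum_le x nk; apply.
by rewrite lerD2l lerD2r w_le1.
Qed.

Lemma mixture_homo : {homo mixture : x y / x <= y}.
Proof.
move=> x y xy; apply/ler_addgt0Pr => e e0.
have /cvgrPdist_le /(_ _ e0) [p _ /(_ p (leqnn p)) hp] := w_cvg.
have wp : 1 - w p <= e by apply: le_trans hp; exact: ler_norm.
have /andP[_ /le_trans] := mixture_bounds p x; apply.
have /andP[h _] := mixture_bounds p y; apply: lerD => //; apply: le_trans h.
by apply: ler_sum => k _; rewrite ler_wpM2l ?ramp_homo// subr_ge0 w_homo.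
Qed.

Lemma mixture_ge0 x : 0 <= mixture x.
Proof. by have /andP[+ _] := mixture_bounds 0 x; rewrite /mixture_sum big_geq. Qed.

Lemma mixture_le1 x : mixture x <= 1.
Proof.
by have /andP[_] := mixture_bounds 0 x; rewrite /mixture_sum big_geq// add0r w0 subr0.
Qed.

Lemma mixture_ge n x : (forall k, (k < n)%N -> v k <= x) -> w n <= mixture x.
Proof.
move=> h; have /andP[+ _] := mixture_bounds n x; apply: le_trans.
rewrite -[leLHS]subr0 -[X in _ - X <= _]w0 -telescope_sumr//
  le_eqVlt; apply/orP; left; apply/eqP.
by apply: eq_big_nat => k /andP[_ kn]; rewrite ramp_eq1 ?mulr1// h.
Qed.

Lemma mixture_le n x : (forall k, (n <= k)%N -> x <= a k) -> mixture x <= w n.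
Proof.
move=> h; apply/ler_addgt0Pr => e e0.
have [p np wp] : exists2 p, (n <= p)%N & 1 - w p <= e.
  have /cvgrPdist_le /(_ _ e0) [p _ hp] := w_cvg.
  exists (maxn n p); first exact: leq_maxl.
  by apply: le_trans (hp _ (leq_maxr n p)); exact: ler_norm.
have /andP[_ /le_trans] := mixture_bounds p x; apply.
apply: lerD => //; rewrite /mixture_sum (big_cat_nat (leq0n n) np)//=.
rewrite [X in _ + X]big_nat [X in _ + X]big1 ?addr0; last first.
  by move=> k /andP[nk _]; rewrite ramp_eq0 ?mulr0// h.
rewrite -[leRHS]subr0 -[X in _ <= _ - X]w0 -telescope_sumr//.
apply: ler_sum => k _.
by rewrite ler_piMr ?ramp_le1// subr_ge0 w_homo.
Qed.

Lemma continuous_mixture : continuous mixture.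
Proof.
move=> x; apply/cvgrPdist_le => e e0.
have e3 : 0 < e / 2 by rewrite divr_gt0.
have /cvgrPdist_le /(_ _ e3) [p _ /(_ p (leqnn p)) hp] := w_cvg.
have wp : 1 - w p <= e / 2 by apply: le_trans hp; exact: ler_norm.
have cS : {for x, continuous (mixture_sum p)}.
  rewrite /mixture_sum; apply: cvg_big => [|k _]; first exact: add_continuous.
  apply: cvgMl_tmp; exact: continuous_ramp.
move/cvgrPdist_le : cS => /(_ _ e3); apply: filterS => y.
(* The neglected tail lies in [[0, 1 - w p]] at both points, so it changes the difference by at most
   [e / 2], not twice that. *)
have := mixture_bounds p x; have := mixture_bounds p y.
rewrite !ler_norml; lra.
Qed.

Lemma mixture_cvgNy : mixture @ -oo --> (0 : R).
Proof.
apply/cvgrPdist_le => e e0; exists m; split => [|x /ltW xm]; first exact: num_real.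
rewrite sub0r normrN ger0_norm ?mixture_ge0//; apply: le_trans (ltW e0).
by rewrite -w0; apply: mixture_le => k _; exact: le_trans (ma k).
Qed.

Lemma mixture_cvgy : mixture @ +oo --> (1 : R).
Proof.
apply/cvgrPdist_le => e e0.
have /cvgrPdist_le /(_ _ e0) [p _ /(_ p (leqnn p)) hp] := w_cvg.
exists (\big[Num.max/0]_(k < p) v k); split => [|x /ltW xm]; first exact: num_real.
rewrite ger0_norm ?subr_ge0 ?mixture_le1//.
apply: le_trans hp; rewrite ger0_norm ?subr_ge0 ?w_le1// lerD2l lerN2.
apply: mixture_ge => k kp; apply: le_trans xm.
by rewrite (bigmaxD1 (Ordinal kp))//= le_max lexx.
Qed.

End mixture.

(** * Joint distribution functions *)

Section joint_distribution.
Context d (T : measurableType d) (R : realType) (P : probability T R).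
Implicit Types (X : nat -> {RV P >-> R}) (l : seq nat) (x y : R).

(** Arbitrary lists of indices are allowed, so that blocks separated by gaps and sparse subsequences
    are treated alike. *)
Definition below X l x : set T := [set w | all (fun i => X i w <= x) l].

Definition joint_df X l x : R := fine (P (below X l x)).

Lemma belowE X l x : below X l x = \big[setI/setT]_(i <- l) (X i @^-1` `]-oo, x]).
Proof.
elim: l => [|i l IH]; first by rewrite big_nil; apply/seteqP; split.
rewrite big_cons -IH; apply/seteqP; split => w; rewrite /below /= in_itv /=.
  by move=> /andP[].
by case=> -> ->.
Qed.

Lemma measurable_below X l x : measurable (below X l x).
Proof.
rewrite belowE; elim/big_ind : _ => // [A B mA mB|i _]; first exact: measurableI.
rewrite -[X in measurable X]setTI; apply: measurable_funP => //.
Qed.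

Lemma joint_dfE X l x : (joint_df X l x)%:E = P (below X l x).
Proof. by rewrite /joint_df fineK// fin_num_measure//; exact: measurable_below. Qed.

Lemma below_cat X l l' x : below X (l ++ l') x = below X l x `&` below X l' x.
Proof.
apply/seteqP; split => w; rewrite /below /= all_cat; first by move=> /andP[].
by case=> -> ->.
Qed.

Lemma joint_df_ge0 X l x : 0 <= joint_df X l x.
Proof. by rewrite -lee_fin joint_dfE. Qed.

Lemma joint_df_le1 X l x : joint_df X l x <= 1.
Proof. by rewrite -lee_fin joint_dfE probability_le1//; exact: measurable_below. Qed.

Lemma joint_df_nil X x : joint_df X [::] x = 1.
Proof.
apply/EFin_inj; rewrite joint_dfE (_ : below _ _ _ = setT) ?probability_setT//.
by apply/seteqP; split.
Qed.

Lemma joint_df1 X x : joint_df X [:: 0%N] x = marginal_df X x.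
Proof.
rewrite /marginal_df /joint_df /cdf /distribution /pushforward; congr (fine (P _)).
by apply/seteqP; split => w; rewrite /below /= in_itv /= andbT.
Qed.

Lemma le_joint_df X l l' x : {subset l' <= l} -> joint_df X l x <= joint_df X l' x.
Proof.
move=> s; rewrite -lee_fin !joint_dfE le_measure ?inE//; try exact: measurable_below.
by move=> w /allP h; apply/allP => i /s /h.
Qed.

Lemma joint_df_homo X l : {homo joint_df X l : x y / x <= y}.
Proof.
move=> x y xy; rewrite -lee_fin !joint_dfE le_measure ?inE//; try exact: measurable_below.
by move=> w /allP h; apply/allP => i /h /le_trans; exact.
Qed.

Lemma measurable_all_le n x :
  measurable [set t : n.-tuple R | all (fun z => z <= x) t].
Proof.
rewrite (_ : mkset _ =
    \big[setI/setT]_(i < n) ((@tnth n R ^~ i) @^-1` `]-oo, x])); last first.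
  rewrite -bigcap_seq /=.
  apply/seteqP; split => t /=.
    by move=> /all_tnthP h i _ /=; rewrite in_itv /=.
  move=> h; apply/all_tnthP => i; have /= := h i; rewrite in_itv /=; apply.
  by rewrite mem_index_enum.
elim/big_ind : _ => // [A B mA mB|i _]; first exact: measurableI.
rewrite -[X in measurable X]setTI; apply: measurable_tnth => //.
Qed.

Lemma all_subvector X n (j : n.-tuple nat) x w :
  all (fun z => z <= x) (subvector X j w) = all (fun i => X i w <= x) j.
Proof.
apply/all_tnthP/all_tnthP => h i; have := h i; by rewrite tnth_mktuple.
Qed.

Lemma joint_df_shift X l h x : stationary X ->
  joint_df X (map (addn h) l) x = joint_df X l x.
Proof.
move=> sX; have := sX (size l) h (in_tuple l) _ (@measurable_all_le (size l) x).
rewrite /joint_df => e; congr fine; rewrite /below.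
transitivity (P (subvector X (in_tuple l) @^-1`
   [set t : (size l).-tuple R | all (fun z => z <= x) t])); last first.
  by congr (P _); apply/seteqP; split => w /=; rewrite all_subvector.
rewrite -e; congr (P _).
have -> : map (addn h) l = [tuple (tnth (in_tuple l) k + h)%N | k < size l].
  rewrite -[X in map (addn h) X](map_tnth_enum (in_tuple l)) /= -map_comp.
  by apply: eq_map => k /=; rewrite addnC.
by apply/seteqP; split => w /=; rewrite all_subvector.
Qed.

(** The left-hand side is the covariance of the indicators of the two events, which are admissible
    test functions; 4 undoes the normalisation of [alpha_coef]. *)
Lemma joint_df_mixing X l l' r (a : R) x : 0 <= a ->
  (alpha_coef X r <= a%:E)%E -> sorted leq l -> sorted leq l' ->
  (forall i j, i \in l -> j \in l' -> i + r <= j)%N ->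
  `|joint_df X (l ++ l') x - joint_df X l x * joint_df X l' x| <= 4 * a.
Proof.
move=> a0 ha.
(* Empty blocks are settled separately, since [alpha_coef] ranges over nonempty tuples only. *)
case: l => [|i0 l] sl.
  by rewrite /= joint_df_nil mul1r subrr normr0 mulr_ge0.
case: l' => [|j0 l'] sl' hr.
  by rewrite /= cats0 joint_df_nil mulr1 subrr normr0 mulr_ge0.
set i := i0 :: l; set j := j0 :: l'.
pose ti : (size l).+1.-tuple nat := in_tuple i.
pose tj : (size l').+1.-tuple nat := in_tuple j.
pose f n : n.-tuple R -> R := \1_([set t : n.-tuple R | all (fun z => z <= x) t]).
have tf n : test_function (f n.+1).
  split.
  - by apply: measurable_indic; exact: measurable_all_le.
  - by move=> t; rewrite /f indicE; case: (_ \in _) => /=; rewrite ?normr1 ?normr0.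
  - exists [tuple x | _ < n.+1], [tuple x + 1 | _ < n.+1].
    rewrite /f !indicE.
    rewrite mem_set; last by apply/all_tnthP => k; rewrite tnth_mktuple.
    rewrite memNset; first by rewrite oner_neq0.
    move=> /(@all_tnthP _ _ _ [tuple x + 1 | _ < n.+1]) /(_ ord0).
    by rewrite tnth_mktuple gerDl ler10.
have fE n (t : n.-tuple nat) : f n \o subvector X t = \1_(below X t x).
  apply/funext => w; rewrite /f /= !indicE; congr (nat_of_bool _)%:R.
  by apply/idP/idP; rewrite !inE /= /below /= all_subvector.
have L1 A : measurable A -> (\1_A : T -> R) \in Lfun P 1.
  by move=> mA; apply/Lfun1_integrable; exact: integrable_indic.
have covE : covariance P (f _ \o subvector X ti) (f _ \o subvector X tj)
    = (joint_df X (i ++ j) x - joint_df X i x * joint_df X j x)%:E.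
  rewrite !fE.
  have m1 := measurable_below X ti x; have m2 := measurable_below X tj x.
  have eI : (\1_(below X ti x) * \1_(below X tj x))%R =
      \1_(below X (i ++ j) x) :> (T -> R).
    by rewrite below_cat indicI.
  rewrite covarianceE ?L1// eI; last by apply: L1; exact: measurable_below.
  rewrite !expectation_indic//; last exact: measurable_below.
  by rewrite EFinB EFinM !joint_dfE.
have : (`|covariance P (f _ \o subvector X ti) (f _ \o subvector X tj)|
          * (4^-1)%:E <= a%:E)%E.
  apply: (le_trans _ ha); apply: ereal_sup_ubound.
  exists (size l), (size l'), ti, tj, (f _), (f _); split => //.
  by apply: hr; exact: mem_tnth.
by rewrite covE /= -EFinM lee_fin ler_pdivrMr// (mulrC a).
Qed.

End joint_distribution.

(** * Distribution functions of maxima over blocks of a stationary sequence *)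

Section maxima.
Context d (T : measurableType d) (R : realType) (P : probability T R).
Context (X : nat -> {RV P >-> R}).
Hypothesis statX : stationary X.
Implicit Types (l : seq nat) (x y a : R).

Local Notation F := (marginal_df X).
Local Notation H n x := (joint_df X (iota 0 n) x).

(** What is lost lies in [A \ A'] or in [B \ B']. With [A' = A] and [B] the whole space this bounds
    the cost of one more index; with two levels it gives the Lipschitz bound in terms of [F]. *)
Lemma probability_setIB (A A' B B' : set T) :
  measurable A -> measurable A' -> measurable B -> measurable B' ->
  A' `<=` A -> B' `<=` B ->
  fine (P (A `&` B)) - fine (P (A' `&` B')) <=
  (fine (P A) - fine (P A')) + (fine (P B) - fine (P B')).
Proof.
move=> mA mA' mB mB' sA sB.
have mD : measurable (A `\` A') by exact: measurableD.
have mE : measurable (B `\` B') by exact: measurableD.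
have PD (C C' : set T) : measurable C -> measurable C' -> C' `<=` C ->
    (P C = P C' + P (C `\` C'))%E.
  move=> mC mC' CC'; rewrite -measureU//; last 2 first.
  - exact: measurableD.
  - by rewrite setDIK.
  by rewrite setDUK.
have fP (C : set T) : measurable C -> P C \is a fin_num.
  by move=> mC; rewrite fin_num_measure.
have : (P (A `&` B) <= P (A' `&` B') + P (A `\` A') + P (B `\` B'))%E.
  apply: (@le_trans _ _ (P (((A' `&` B') `|` (A `\` A')) `|` (B `\` B')))).
    rewrite le_measure ?inE//; first exact: measurableI.
      by do 2 (apply: measurableU => //); exact: measurableI.
    move=> w [Aw Bw]; have [A'w|A'w] := pselect (A' w); last by left; right.
    by have [B'w|B'w] := pselect (B' w); [left; left|right].
  apply: (le_trans (measureU2 _ _ _)) => //.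
    by apply: measurableU => //; exact: measurableI.
  apply: leeD => //; apply: measureU2 => //; exact: measurableI.
have eA := PD _ _ mA mA' sA; have eB := PD _ _ mB mB' sB.
move: eA eB; rewrite -(fineK (fP _ mA)) -(fineK (fP _ mA')) -(fineK (fP _ mB)).
rewrite -(fineK (fP _ mB')) -(fineK (fP _ mD)) -(fineK (fP _ mE)).
rewrite -(fineK (fP _ (measurableI _ _ mA mB))).
rewrite -(fineK (fP _ (measurableI _ _ mA' mB'))).
rewrite -!EFinD => -[->] [->]; rewrite lee_fin /=; lra.
Qed.

Lemma joint_df_seq1 i x : joint_df X [:: i] x = F x.
Proof. by rewrite -joint_df1 -(joint_df_shift [:: 0%N] i x statX) /= addn0. Qed.

Lemma marginal_df_ge0 x : 0 <= F x.
Proof. by rewrite -joint_df1 joint_df_ge0. Qed.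

Lemma marginal_df_le1 x : F x <= 1.
Proof. by rewrite -joint_df1 joint_df_le1. Qed.

Lemma marginal_df_homo : {homo F : x y / x <= y}.
Proof. by move=> x y xy; rewrite -!joint_df1; exact: joint_df_homo. Qed.

Lemma joint_df_cat_ge l l' x :
  joint_df X l x - (size l')%:R * (1 - F x) <= joint_df X (l ++ l') x.
Proof.
elim: l' l => [|i l' IH] l; first by rewrite mul0r subr0 cats0.
rewrite -cat_rcons; apply: le_trans (IH _).
rewrite -cats1 /=; have := probability_setIB (measurable_below X l x)
  (measurable_below X l x) measurableT (measurable_below X [:: i] x)
  (@subset_refl _ _) (@subsetT _ _).
rewrite setIT -below_cat probability_setT subrr add0r.
rewrite -!/(joint_df X _ x) joint_df_seq1 /= -natr1; lra.
Qed.

Lemma joint_df_lip l x y : y <= x ->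
  joint_df X l x - joint_df X l y <= (size l)%:R * (F x - F y).
Proof.
move=> yx; elim: l => [|i l IH]; first by rewrite !joint_df_nil subrr mul0r.
have sub k : below X k y `<=` below X k x.
  by move=> w /allP h; apply/allP => j /h /le_trans; exact.
have := probability_setIB (measurable_below X [:: i] x)
  (measurable_below X [:: i] y) (measurable_below X l x)
  (measurable_below X l y) (@sub _) (@sub _).
rewrite -!below_cat /= -!/(joint_df X _ _) !joint_df_seq1 /= -natr1; lra.
Qed.

Lemma max_df_homo n m x : (n <= m)%N -> H m x <= H n x.
Proof.
move=> nm; apply: le_joint_df => i; rewrite !mem_iota !add0n /= => h.
exact: leq_trans nm.
Qed.

Lemma max_df_ge n x : 1 - n%:R * (1 - F x) <= H n x.
Proof. by have := joint_df_cat_ge [::] (iota 0 n) x; rewrite joint_df_nil size_iota. Qed.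

Lemma max_df_lip n x y : y <= x -> H n x - H n y <= n%:R * (F x - F y).
Proof. by move=> yx; have := joint_df_lip (iota 0 n) yx; rewrite size_iota. Qed.

Lemma running_max_df n x : (0 < n)%N ->
  P [set w | running_max X n w <= x] = (H n x)%:E.
Proof.
move=> n0; rewrite joint_dfE; congr (P _); apply/seteqP; split => w /=.
  rewrite /running_max => h; apply/allP => i; rewrite mem_iota add0n /= => ni.
  apply: le_trans h; rewrite (bigmaxD1 (Ordinal ni))//= le_max lexx //.
move=> /allP h; apply/bigmax_leP; split => [|i _]; apply: h;
  by rewrite mem_iota add0n /= ?n0 ?ltn_ord.
Qed.

(** Dropping the [r] indices after the first block costs [r (1 - F x)], decoupling the remaining
    blocks costs [4 a], and completing the second block to length [q] costs [r (1 - F x)] again. If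
    [q < r], truncated subtraction makes the shortened block empty and the bounds still hold. *)
Lemma max_df_approx_mul (r : nat) a x p q : 0 <= a -> (alpha_coef X r <= a%:E)%E ->
  `|H (p + q) x - H p x * H q x| <= 4 * a + 2 * (r%:R * (1 - F x)).
Proof.
move=> a0 ra; pose q' := (q - r)%N.
set g := r%:R * (1 - F x).
have g0 : 0 <= g by rewrite mulr_ge0// subr_ge0 marginal_df_le1.
set M := joint_df X (iota 0 p ++ iota (p + r) q') x.
have M1 : H (p + q) x <= M.
  apply: le_joint_df => i; rewrite mem_cat !mem_iota /q'; lia.
have M2 : M - g <= H (p + q) x.
  have := joint_df_cat_ge (iota 0 p ++ iota (p + r) q') (iota p r) x.
  rewrite size_iota => /le_trans; apply.
  by apply: le_joint_df => i; rewrite !mem_cat !mem_iota /q'; lia.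
have M3 : `|M - H p x * H q' x| <= 4 * a.
  have -> : H q' x = joint_df X (iota (p + r) q') x.
    by rewrite -[in RHS](addn0 (p + r)%N) iotaDl joint_df_shift.
  apply: (@joint_df_mixing _ _ _ _ _ _ _ r) => //; try exact: iota_sorted.
  by move=> i j; rewrite !mem_iota; lia.
have q1 : H q x <= H q' x by apply: max_df_homo; rewrite /q' leq_subr.
have q2 : H q' x - g <= H q x.
  have := joint_df_cat_ge (iota 0 q') (iota q' r) x.
  rewrite size_iota => /le_trans; apply.
  by apply: le_joint_df => i; rewrite !mem_cat !mem_iota /q'; lia.
have p0 := joint_df_ge0 X (iota 0 p) x; have p1 := joint_df_le1 X (iota 0 p) x.
have N1 : H p x * H q x <= H p x * H q' x by rewrite ler_wpM2l.
have N2 : H p x * H q' x <= H p x * H q x + g.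
  apply: (@le_trans _ _ (H p x * (H q x + g))); first by rewrite ler_wpM2l//; lra.
  by rewrite mulrDr lerD2l ler_piMl.
move: M3; rewrite !ler_norml; lra.
Qed.

(** Only the indices [0, r, ..., (s - 1) r] are kept; they are split off one at a time, each at a
    cost of [4 a]. *)
Lemma max_df_le_exp (r s n : nat) a x : 0 <= a -> (alpha_coef X r <= a%:E)%E ->
  (0 < r)%N -> (r * s <= n)%N -> H n x <= F x ^+ s + 4 * s%:R * a.
Proof.
move=> a0 ra r0 rsn.
apply: (@le_trans _ _ (joint_df X (map (muln r) (iota 0 s)) x)).
  apply: le_joint_df => i /mapP[j]; rewrite mem_iota add0n /= => js ->.
  rewrite mem_iota add0n /=; apply: leq_trans rsn.
  by rewrite ltn_pmul2l.
elim: s {rsn} => [|s IH]; first by rewrite joint_df_nil expr0 mulr0 mul0r addr0.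
rewrite -addn1 iotaD add0n map_cat addn1; set A := map _ _.
have : `|joint_df X (A ++ [:: (r * s)%N]) x -
    joint_df X A x * joint_df X [:: (r * s)%N] x| <= 4 * a.
  apply: (@joint_df_mixing _ _ _ _ _ _ _ r) => //.
    by rewrite sorted_map; apply: sub_sorted (iota_sorted 0 s) => i j; rewrite /= leq_pmul2l.
  move=> i j /mapP[k]; rewrite mem_iota add0n /= => ks ->; rewrite inE => /eqP ->.
  by rewrite addnC -mulnS leq_pmul2l.
rewrite joint_df_seq1 => h.
have F0 := marginal_df_ge0 x; have F1 := marginal_df_le1 x.
have h2 : joint_df X A x * F x <= F x ^+ s.+1 + 4 * s%:R * a.
  apply: (@le_trans _ _ ((F x ^+ s + 4 * s%:R * a) * F x)); first exact: ler_wpM2r.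
  by rewrite mulrDl -exprSr lerD2l ler_piMr// !mulr_ge0.
move: h; rewrite ler_norml -natr1 => /andP[_]; lra.
Qed.

End maxima.

(** * Levels of the maxima *)

Section levels.
Context d (T : measurableType d) (R : realType) (P : probability T R).
Context (X : nat -> {RV P >-> R}).
Hypothesis statX : stationary X.
Hypothesis mixX : alpha_mixing X.
Implicit Types (x y e : R).

Local Notation F := (marginal_df X).
Local Notation H n x := (joint_df X (iota 0 n) x).
Local Notation q := (expR (-1) : R).

(** Values within 1/8 of [q] then lie between 1/8 and 3/4, as [approx_mul_close] requires. *)
Lemma expRN1_bounds : 4^-1 <= q <= 2^-1.
Proof.
apply/andP; split; last first.
  by rewrite expRN lef_pV2 ?posrE ?expR_gt0//; have := expR_ge1Dx (1 : R).
have -> : (-1 : R) = 2%:R * - 2^-1 by rewrite mulrN divff.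
rewrite expRM_natl; have h := expR_ge1Dx (- 2^-1 : R).
apply: (@le_trans _ _ ((2^-1) ^+ 2)); first by lra.
by rewrite lerXn2r ?nnegrE ?expR_ge0//; lra.
Qed.

Lemma alpha_coef_small e : 0 < e ->
  exists r, (0 < r)%N /\ (alpha_coef X r <= e%:E)%E.
Proof.
move=> e0; have := mixX; move/fine_cvgP => [[n1 _ hn1]] /cvgrPdist_le /(_ _ e0)[n2 _ hn2].
pose r := (maxn n1 n2).+1; exists r; split => //.
have f1 : alpha_coef X r \is a fin_num.
  by apply: hn1; rewrite /r /=; exact: leqW (leq_maxl _ _).
rewrite -(fineK f1) lee_fin.
have := hn2 r (leqW (leq_maxr _ _)); rewrite sub0r normrN /= => /(le_trans _); apply.
exact: ler_norm.
Qed.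

(** First [s] makes [F x ^ s] small, then the gap [r], chosen after [s], makes [4 s alpha(r)]
    small. *)
Lemma max_df_cvg0 x e : F x < 1 -> 0 < e ->
  exists n0, forall n, (n0 <= n)%N -> H n x <= e.
Proof.
move=> Fx e0; have e2 : 0 < e / 2 by rewrite divr_gt0.
have F0 := marginal_df_ge0 X x.
have : (fun n => F x ^+ n) @ \oo --> (0 : R) by apply: cvg_expr; rewrite ger0_norm.
move=> /cvgrPdist_le /(_ _ e2) [s0 _ hs]; pose s := s0.+1.
have := hs s (leqnSn _); rewrite sub0r normrN ger0_norm ?exprn_ge0// => hFs.
have a0 : 0 < e / (8 * s%:R) by rewrite divr_gt0// mulr_gt0.
have [r [r0 ra]] := alpha_coef_small a0.
exists (r * s)%N => n rn.
apply: (le_trans (max_df_le_exp statX x (ltW a0) ra r0 rn)).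
suff -> : 4 * s%:R * (e / (8 * s%:R)) = e / 2 by lra.
have s0' : s%:R != 0 :> R by rewrite pnatr_eq0.
by field.
Qed.

(** Half of [e] pays for mixing, which fixes the gap [r]; the other half pays for the gap, which
    fixes how close [F x] must be to 1. *)
Lemma max_df_approx e : 0 < e -> exists dl : R, 0 < dl /\
  forall x, 1 - F x <= dl -> approx_mul e (fun n => H n x).
Proof.
move=> e0; have a0 : 0 < e / 8 by rewrite divr_gt0.
have [r [r0 ra]] := alpha_coef_small a0.
have r0' : 0 < r%:R :> R by rewrite ltr0n.
exists (e / 4 / r%:R); split; first by rewrite !divr_gt0.
move=> x; rewrite ler_pdivlMr// mulrC => xr; split.
- by rewrite joint_df_nil.
- by move=> n; rewrite joint_df_ge0 joint_df_le1.
- by move=> n m; exact: max_df_homo.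
- move=> p p'; apply: (le_trans (max_df_approx_mul statX x p p' (ltW a0) ra)); lra.
Qed.

Lemma marginal_df_right x e : 0 < e -> exists y, x < y /\ F y - F x <= e.
Proof.
move=> e0; have : fine (cdf (X 0%N) y) @[y --> x^'+] --> F x.
  apply: fine_cvg; rewrite /marginal_df fineK; first exact: cdf_right_continuous.
  by rewrite /cdf fin_num_measure.
move=> /cvgrPdist_le /(_ _ e0) h.
near (x^'+) => y; exists y; split; first by near: y; exact: nbhs_right_gt.
have : `|F x - F y| <= e by near: y.
by rewrite ler_norml; lra.
Unshelve. all: by end_near. Qed.

Lemma marginal_df_left e : 0 < e -> exists x, F x < e.
Proof.
move=> e0; have : fine (cdf (X 0%N) y) @[y --> -oo] --> (0 : R).
  by apply: fine_cvg; exact: cvg_cdfNy0.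
move=> /cvgrPdist_lt /(_ _ e0) h.
near (-oo : set_system R) => y; exists y.
have : `|0 - F y| < e by near: y.
by rewrite ltr_norml; lra.
Unshelve. all: by end_near. Qed.

(* [k.-1.+1] is [maxn k 1]: the value at [k = 0] would otherwise be a junk
   infimum, since [H 0 x = 1] for all [x]. *)
Definition level k : R := inf [set x | q <= H k.-1.+1 x].

Hypothesis F_near1 : forall e, 0 < e -> exists x, 1 - e < F x < 1.

Lemma max_df_reaches k : exists x, F x < 1 /\ q <= H k x.
Proof.
have /andP[_ q2] := expRN1_bounds.
have k0 : 0 < (2 * k.+1%:R)^-1 :> R by rewrite invr_gt0 mulr_gt0.
have [x /andP[/ltW x1 x2]] := F_near1 k0; exists x; split => //.
apply: le_trans (max_df_ge statX k x).
suff : k%:R * (1 - F x) <= 2^-1 by lra.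
apply: (@le_trans _ _ (k.+1%:R * (2 * k.+1%:R)^-1)).
  by apply: ler_pM => //; [lra | rewrite ler_nat | rewrite lerBlDr -lerBlDl].
by rewrite invfM mulrCA divff ?mulr1// pnatr_eq0.
Qed.

Lemma max_df_le_marginal k x : (0 < k)%N -> H k x <= F x.
Proof.
move=> k0; rewrite -joint_df1; apply: le_joint_df => i; rewrite inE => /eqP ->.
by rewrite mem_iota.
Qed.

(** The infimum is attained: the maximum's distribution function is Lipschitz in [F], hence
    right-continuous. The set is bounded below because [H k <= F] for positive [k], and nonempty by
    [max_df_reaches]. *)
Lemma level_le k x : (level k <= x) = (q <= H k.-1.+1 x).
Proof.
have [q4 _] := andP expRN1_bounds.
have [z zq] : exists z, F z < q by apply: marginal_df_left; exact: expR_gt0.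
have hb : lbound [set x | q <= H k.-1.+1 x] z.
  move=> y /= hy; rewrite leNgt; apply/negP => yz.
  have := le_trans hy (max_df_le_marginal y (ltn0Sn _)).
  by rewrite leNgt (le_lt_trans _ zq)// marginal_df_homo// ltW.
apply/idP/idP => h; last by apply: ge_inf => //; exists z.
apply/ler_addgt0Pr => e e0.
have k0 : 0 < k.-1.+1%:R :> R by [].
have [y [xy hy]] := marginal_df_right x (divr_gt0 e0 k0).
have [w hw wy] : exists2 w, q <= H k.-1.+1 w & w < y.
  apply: inf_lt; last exact: le_lt_trans xy.
  by have [w [_ hw]] := max_df_reaches k.-1.+1; exists w.
have h1 : H k.-1.+1 w <= H k.-1.+1 y by apply: joint_df_homo; exact: ltW.
have := max_df_lip statX k.-1.+1 (ltW xy).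
move: hy; rewrite ler_pdivlMr// mulrC; lra.
Qed.

Lemma level_homo i j : (i <= j)%N -> level i <= level j.
Proof.
move=> ij; rewrite level_le; apply: (@le_trans _ _ (H j.-1.+1 (level j))).
  by rewrite -level_le.
by apply: max_df_homo; lia.
Qed.

Lemma marginal_level_lt1 k : F (level k) < 1.
Proof.
have [x [x1 hx]] := max_df_reaches k.-1.+1; apply: le_lt_trans x1.
by apply: marginal_df_homo; rewrite level_le.
Qed.

(** The left limit of [F] at [x] is replaced by the value at some [y < x], which is all that the
    comparison of levels needs. *)
Definition small_jumps := forall e, 0 < e -> exists n0, forall n x, (n0 <= n)%N ->
  F x < 1 -> q <= H n x -> exists y, y < x /\ n%:R * (F x - F y) <= e.

Hypothesis jumpsX : small_jumps.

(** At a fixed [x1] with [F x1 < 1] the maxima have vanishing probability of staying below, so for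
    large [n] the condition forces [x] beyond [x1]. *)
Lemma max_df_unif e : 0 < e -> exists n0, forall n x, (n0 <= n)%N ->
  q <= H n x -> 1 - F x <= e.
Proof.
move=> e0; have [x1 /andP[x1e x11]] := F_near1 e0.
have [q4 _] := andP expRN1_bounds.
have q2 : 0 < q / 2 by lra.
have [n0 hn0] := max_df_cvg0 x11 q2.
exists n0 => n x nn qx; have [xx1|xx1] := leP x1 x.
  by have := marginal_df_homo X xx1; lra.
have := joint_df_homo X (iota 0 n) (ltW xx1).
by have := hn0 _ nn; lra.
Qed.

(* If [level j = level k = v], then [H j v] is close to [q <= H k v] because
   the jump at [v] is small, so [H (k - j) v] is close to 1, and hence so is
   [H j v] because [j] is at most a fixed multiple of [k - j]. *)
Lemma level_lt b : (0 < b)%N -> exists k0, forall k j, (k0 <= k)%N ->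
  (b.+1 * j <= b * k)%N -> level j < level k.
Proof.
move=> b0; have [q4 q2] := andP expRN1_bounds.
have b0' : 1 <= b%:R :> R by rewrite ler1n.
(* The argument ends with [1 - 9 b e <= q + e]; since [q <= 1/2] and [e <= b e], this is absurd as
   soon as [b e < 1/20]. *)
pose e : R := (21 * b%:R)^-1.
have eb : b%:R * e = 21^-1 by rewrite /e invfM mulrCA divff ?mulr1// pnatr_eq0 -lt0n.
have e0 : 0 < e by rewrite /e invr_gt0; lra.
have [dl [dl0 hdl]] := max_df_approx e0.
have [n1 hn1] := max_df_unif dl0; have [n2 hn2] := jumpsX e0.
exists (maxn 2 (maxn n1 n2)) => k j'; rewrite !geq_max => /and3P[k2 kn1 kn2] bj'.
(* [level] replaces index 0 by 1; the inequality between indices survives this because [k >= 2]. *)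
pose j := j'.-1.+1.
have bj : (b.+1 * j <= b * k)%N.
  rewrite /j {j}; case: j' bj' => // _; rewrite muln1.
  by apply: (@leq_trans (b * 2)%N); [lia | rewrite leq_pmul2l].
rewrite ltNge; apply/negP; set v := level k => vj.
have kk : k.-1.+1 = k by lia.
have qv : q <= H k v by rewrite -[in H k v]kk -level_le.
have [y [yv kF]] := hn2 _ _ kn2 (marginal_level_lt1 k) qv.
have jk : (j <= k)%N by nia.
have qj : H j v <= q + e.
  have : H j y < q by rewrite ltNge -level_le -ltNge; exact: lt_le_trans vj.
  have := max_df_lip statX j (ltW yv).
  have : j%:R * (F v - F y) <= k%:R * (F v - F y).
    by rewrite ler_wpM2r ?ler_nat// subr_ge0 marginal_df_homo// ltW.
  lra.
have av := hdl _ (hn1 _ _ kn1 qv); have [_ h01 hd hM] := av.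
pose h := H (k - j) v.
have /andP[h0 h1] := h01 (k - j)%N; rewrite -/h in h0 h1.
(* From [q <= H k v <= (q + e) h + e] one gets [q (1 - h) <= 2 e], and [q >= 1/4]. *)
have h8 : 1 - 8 * e <= h.
  have := hM j (k - j)%N; rewrite subnKC// -/h ler_norml => /andP[_ hh].
  have /andP[j0 j1] := h01 j.
  have := ler_wpM2r h0 qj.
  have : 0 <= (1 - h) * (q - 4^-1) by rewrite mulr_ge0//; lra.
  have : e * h <= e by rewrite ler_piMr// ltW.
  nra.
have hb : 1 - b%:R * (8 * e) <= h ^+ b.
  elim: (b) => [|n IH]; first by rewrite mul0r subr0.
  rewrite exprS; have [le0|ge0] := leP (1 - n%:R * (8 * e)) 0.
    by apply: le_trans (mulr_ge0 h0 (exprn_ge0 n h0)); rewrite -natr1; lra.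
  have := ler_wpM2l h0 IH; have := ler_wpM2r (ltW ge0) h8.
  have : 0 <= 8 * e * (n%:R * (8 * e)) by rewrite !mulr_ge0// ltW.
  by rewrite -natr1; lra.
have := approx_mul_pow b (k - j)%N av; rewrite -/h ler_norml => /andP[hp _].
have jb : (j <= b * (k - j))%N.
  by rewrite mulnBr leq_subRL ?leq_mul2l ?jk ?orbT// addnC -mulSn.
have : e <= b%:R * e by rewrite ler_peMl// ltW.
by have := hd _ _ jb; lra.
Qed.

End levels.

(** * The phantom distribution function *)

Section phantom.
Context d (T : measurableType d) (R : realType) (P : probability T R).
Context (X : nat -> {RV P >-> R}).
Hypothesis statX : stationary X.
Hypothesis mixX : alpha_mixing X.
Implicit Types (x y u e : R).

Local Notation F := (marginal_df X).
Local Notation H n x := (joint_df X (iota 0 n) x).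
Local Notation q := (expR (-1) : R).
Local Notation v := (level X).

Hypothesis F_near1 : forall e, 0 < e -> exists x, 1 - e < F x < 1.
Hypothesis jumpsX : small_jumps X.

(** Chosen so that [weight k ^ k] is [1/e] for positive [k]; the value 0 at 0 makes the total mass
    1. *)
Definition weight k : R := if k is 0%N then 0 else expR (- k%:R^-1).

(** The default [v k - 1] keeps the ramp nondegenerate when no earlier level is strictly smaller. It
    always enters the maximum, so every ramp has length at most 1. *)
Definition prev_level k : R :=
  \big[Num.max/v k - 1]_(j < k | v j < v k) v j.

Definition phantom : R -> R := mixture weight prev_level v.

Lemma weight_ge0 k : 0 <= weight k.
Proof. by case: k => //= k; exact: expR_ge0. Qed.

Lemma weight_lt1 k : weight k < 1.
Proof. by case: k => //= k; rewrite expR_lt1 oppr_lt0 invr_gt0. Qed.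

Lemma weight_homo i j : (i <= j)%N -> weight i <= weight j.
Proof.
case: i => [|i] ij; first exact: weight_ge0.
case: j ij => // j ij; rewrite /= ler_expR lerN2 lef_pV2 ?posrE//.
by rewrite ler_nat.
Qed.

Lemma weight_cvg1 : weight n @[n --> \oo] --> (1 : R).
Proof.
rewrite -cvg_shiftS.
have h : expR (- harmonic n) @[n --> \oo] --> (expR (- 0) : R).
  apply: continuous_cvg; first exact: continuous_expR.
  by apply: cvgN; exact: cvg_harmonic.
by rewrite oppr0 expR0 in h.
Qed.

Lemma prev_level_lt k : prev_level k < v k.
Proof. by apply/bigmax_ltP; split => //; rewrite ltrBlDr ltrDl. Qed.

Lemma prev_level_ge k : v 0%N - 1 <= prev_level k.
Proof.
apply: (@le_trans _ _ (v k - 1)); last exact: bigmax_ge_id.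
by rewrite lerD2r (level_homo statX F_near1).
Qed.

Lemma level_prev j k : v j < v k -> v j <= prev_level k.
Proof.
move=> jk; have kj : (j < k)%N.
  by rewrite ltnNge; apply: contraTN jk => kj; rewrite -leNgt (level_homo statX F_near1).
by rewrite /prev_level (bigmaxD1 (Ordinal kj))// le_max lexx.
Qed.

Lemma phantom_homo : {homo phantom : x y / x <= y}.
Proof.
apply: mixture_homo => //; [exact: weight_homo|exact: weight_cvg1|exact: prev_level_lt].
Qed.

Lemma continuous_phantom : continuous phantom.
Proof.
apply: continuous_mixture => //; [exact: weight_homo|exact: weight_cvg1].
Qed.

Lemma phantom_cvgNy : phantom @ -oo --> (0 : R).
Proof.
apply: (@mixture_cvgNy _ _ _ _ (v 0%N - 1)) => //.
- exact: weight_homo.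
- exact: weight_cvg1.
- exact: prev_level_lt.
- exact: prev_level_ge.
Qed.

Lemma phantom_cvgy : phantom @ +oo --> (1 : R).
Proof.
apply: mixture_cvgy => //; [exact: weight_homo|exact: weight_cvg1|exact: prev_level_lt].
Qed.

Lemma phantom_ge0 x : 0 <= phantom x.
Proof. apply: mixture_ge0 => //; [exact: weight_homo|exact: weight_cvg1]. Qed.

Lemma phantom_le1 x : phantom x <= 1.
Proof. apply: mixture_le1 => //; [exact: weight_homo|exact: weight_cvg1]. Qed.

Lemma weight_le_phantom n x : (1 < n)%N -> (forall k, (k < n)%N -> q <= H k x) ->
  weight n <= phantom x.
Proof.
move=> n1 h; apply: mixture_ge => //.
- exact: weight_homo.
- exact: weight_cvg1.
- exact: prev_level_lt.
(* For [k = 0] the level is governed by [H 1], whence the assumption [1 < n]. *)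
- by move=> k kn; rewrite (level_le statX F_near1) h//; lia.
Qed.

Lemma phantom_le_weight n x : (forall k, (n <= k)%N -> x <= prev_level k) ->
  phantom x <= weight n.
Proof.
apply: mixture_le => //.
- exact: weight_homo.
- exact: weight_cvg1.
- exact: prev_level_lt.
Qed.

Lemma phantom_eq1 x : F x = 1 -> phantom x = 1.
Proof.
move=> Fx; apply/eqP; rewrite eq_le phantom_le1/=.
rewrite -(cvg_lim _ weight_cvg1)//; apply: limr_le.
  by apply/cvg_ex; exists 1; exact: weight_cvg1.
exists 2 => // n /= n2; apply: weight_le_phantom => // k _.
have [_ q2] := andP (expRN1_bounds R).
by have := max_df_ge statX k x; rewrite Fx; lra.
Qed.

(** An integer index beyond [(1 + 1/b) n], to which [level_lt] applies. *)
Lemma mulS_le_add_div b n : (0 < b)%N -> (b.+1 * n <= b * (n + n %/ b + 1))%N.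
Proof.
move=> b0; rewrite mulSn -addnA mulnDr addnC leq_add2l addn1 mulnC ltnW//.
exact: ltn_ceil.
Qed.

(** For [u] near the right end let [n] be the first index with [H n u < q]. Both [H n u] and
    [phantom u ^ n] are close to [q], and both sequences are approximately multiplicative, so
    [approx_mul_close] extends the agreement to all indices. Where [F u = 1] both are identically
    1. *)
Lemma phantom_approx t : 0 < t -> exists x0, F x0 < 1 /\ phantom x0 < 1 /\
  forall n u, x0 <= u -> `|H n u - phantom u ^+ n| <= t.
Proof.
move=> t0; have [q4 q2] := andP (expRN1_bounds R).
have [e0 [e00 he0]] := approx_mul_close t0.
pose e := Num.min e0 8^-1.
have ee0 : 0 < e by rewrite lt_min e00 /=; lra.
have e8 : e <= 8^-1 by rewrite ge_min lexx orbT.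
have [dl' [dl'0 hdl']] := max_df_approx statX mixX ee0.
have e2 : 0 < e / 2 by rewrite divr_gt0.
pose dl := Num.min dl' (e / 2).
have dl0 : 0 < dl by rewrite lt_min dl'0.
have [s [s0 hs]] : exists s : R, 0 < s /\ expR (-1 + s) <= q + e / 2.
  have /cvgrPdist_le /(_ _ e2) := @continuous_expR R (-1).
  move=> [r /= r0 hr]; exists (r / 2); split; first by rewrite divr_gt0.
  have := hr (-1 + r / 2); rewrite /ball_ /= opprD addrA subrr add0r normrN.
  rewrite gtr0_norm ?divr_gt0// => /(_ _).
  by rewrite ler_norml ltr_pdivrMr// ltr_pMr// ltr1n => /(_ isT) /andP[h1 _]; lra.
(* With [1/b <= s/2] and [n >= b], the index [J n] below is at most [(1 + s) n], so [exp(-n / J n)]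
   stays below [exp(-1 + s)]. *)
pose b := (Num.truncn (2 / s)).+1.
have bs : b%:R^-1 <= s / 2.
  by rewrite -[s / 2]invrK lef_pV2 ?posrE ?invr_gt0 ?divr_gt0// invf_div ltW// truncnS_gt.
have [k0 hk0] := level_lt statX mixX F_near1 jumpsX (ltn0Sn _ : 0 < b)%N.
(* A lower bound for the first passage index: [k0] serves [level_lt], [b] absorbs the final [+ 1] in
   [J n], and 2 serves [weight_le_phantom]. It is enforced by [1 - F x0 < 1 / (2 M)], which keeps
   [H M u] above 1/2. *)
pose M := maxn k0 (maxn b 2).
have Mk0 : (k0 <= M)%N by exact: leq_maxl.
have Mb : (b <= M)%N by rewrite !leq_max leqnn orbT.
have M2 : (2 <= M)%N by rewrite !leq_max leqnn !orbT.
have M0 : 0 < M%:R :> R by rewrite ltr0n (leq_trans _ M2).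
have [x0 /andP[x0d x01]] : exists x, 1 - Num.min dl (2 * M%:R)^-1 < F x < 1.
  by apply: F_near1; rewrite lt_min dl0 invr_gt0 mulr_gt0.
have Fx0dl : 1 - F x0 <= dl by have := ge_min dl dl (2 * M%:R)^-1; rewrite lexx /=; lra.
have HM u n : x0 <= u -> (n <= M)%N -> q <= H n u.
  move=> xu nM; apply: (@le_trans _ _ (H M u)); last exact: max_df_homo.
  apply: (@le_trans _ _ (H M x0)); last exact: joint_df_homo.
  apply: le_trans (max_df_ge statX M x0).
  suff : M%:R * (1 - F x0) <= 2^-1 by lra.
  rewrite mulrC -ler_pdivlMr// -invfM.
  have : Num.min dl (2 * M%:R)^-1 <= (2 * M%:R)^-1 by rewrite ge_min lexx orbT.
  lra.
pose N u n := (M <= n)%N /\ H n u < q /\ forall k, (k < n)%N -> q <= H k u.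
have exN u : x0 <= u -> F u < 1 -> exists n, N u n.
  move=> xu Fu; have q20 : 0 < q / 2 by lra.
  have [n0 hn0] := max_df_cvg0 statX mixX Fu q20.
  have ex : exists n, H n u < q by exists n0; have := hn0 n0 (leqnn _); lra.
  case: (ex_minnP ex) => n nq nmin; exists n; split => //.
    by rewrite leqNgt; apply/negP => /ltnW /(HM u _ xu); rewrite leNgt nq.
  by split => // k kn; rewrite leNgt; apply/negP => /nmin; rewrite leqNgt kn.
pose J n := (n + n %/ b + 1)%N.
(* For [k >= J n] the level [v n], which exceeds [u], is strictly below [v k], hence at most
   [prev_level k]: the ramps from [J n] on have not started at [u]. *)
have GJ u n : N u n -> phantom u <= weight (J n).
  move=> [Mn [nq _]]; apply: phantom_le_weight => k kn; rewrite leNgt; apply/negP => pu.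
  have : v n < v k.
    apply: hk0; first by rewrite (leq_trans Mk0)// (leq_trans Mn)//
      (leq_trans _ kn)// /J -addnA leq_addr.
    apply: (@leq_trans (b * J n)%N); last by rewrite leq_mul2l kn orbT.
    exact: mulS_le_add_div.
  move=> /level_prev vn; have : v n <= u by apply: (le_trans vn); exact: ltW.
  by rewrite (level_le statX F_near1) prednK ?leNgt ?nq//
    (leq_trans _ Mn)// (leq_trans _ M2).
exists x0; split => //; split.
  by have [n /GJ] := exN x0 (lexx _) x01; move=> /le_lt_trans; apply; exact: weight_lt1.
move=> m u xu; have [Fu|Fu] := ltP (F u) 1; last first.
  have F1 : F u = 1 by apply/eqP; rewrite eq_le Fu marginal_df_le1.
  rewrite phantom_eq1// expr1n.
  have := max_df_ge statX m u; rewrite F1 subrr mulr0 subr0 => h.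
  have -> : H m u = 1 by apply/eqP; rewrite eq_le h joint_df_le1.
  by rewrite subrr normr0 ltW.
have [n nN] := exN u xu Fu; have [Mn [nq nmin]] := nN.
have n2 : (1 < n)%N by exact: leq_trans Mn.
have n0 : 0 < n%:R :> R by rewrite ltr0n (leq_trans _ n2).
have Fudl : 1 - F u <= dl by have := marginal_df_homo X xu; lra.
have G0 := phantom_ge0 u; have G1 := phantom_le1 u.
have qG : q <= phantom u ^+ n.
  have h : weight n <= phantom u by exact: weight_le_phantom.
  have <- : weight n ^+ n = q.
    case: (n) n0 => [|n']; rewrite ?ltxx// => n0.
    by rewrite /weight -expRM_natl mulrN divff// gt_eqF.
  by rewrite lerXn2r ?nnegrE ?weight_ge0.
have Gq : phantom u ^+ n <= q + e / 2.
  apply: le_trans hs; apply: (@le_trans _ _ (weight (J n) ^+ n)).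
    by rewrite lerXn2r ?nnegrE ?weight_ge0 ?GJ.
  have J0 : 0 < (J n)%:R :> R by rewrite ltr0n /J addn1.
  rewrite /weight {1}/J addn1 -/(J n) -expRM_natl ler_expR mulrN.
  have b0 : 0 < b%:R :> R by [].
  have nb : (n %/ b)%:R <= n%:R * (s / 2).
    apply: (@le_trans _ _ (n%:R * b%:R^-1)); last by rewrite ler_wpM2l.
    by rewrite ler_pdivlMr// -natrM ler_nat leq_divM.
  have n1 : 1 <= n%:R * (s / 2).
    apply: (@le_trans _ _ (n%:R * b%:R^-1)); last by rewrite ler_wpM2l.
    by rewrite ler_pdivlMr// mul1r ler_nat (leq_trans Mb).
  have Jn : (J n)%:R <= n%:R * (1 + s) by rewrite /J !natrD; lra.
  (* For [s <= 1] this rests on [(1 - s) (1 + s) <= 1]; for [s > 1] the left side is negative. *)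
  suff : 1 - s <= n%:R / (J n)%:R by lra.
  rewrite ler_pdivlMr//; have [s1|s1] := leP s 1; last by nra.
  apply: (@le_trans _ _ ((1 - s) * (n%:R * (1 + s)))); first by rewrite ler_wpM2l//; lra.
  have : 0 <= n%:R * s ^+ 2 by rewrite mulr_ge0// exprn_ge0// ltW.
  nra.
(* At index [n - 1] the value is still at least [q], and the last variable costs at most
   [1 - F u <= e / 2]. *)
have Hq : q - e / 2 <= H n u.
  have nn : (n.-1.+1 = n)%N by rewrite prednK// (leq_trans _ n2).
  have := nmin n.-1 (_ : (n.-1 < n)%N); rewrite nn => /(_ (leqnn _)).
  have := joint_df_cat_ge statX (iota 0 n.-1) [:: n.-1] u.
  have -> : iota 0 n.-1 ++ [:: n.-1] = iota 0 n by rewrite -[in RHS]nn -addn1 iotaD.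
  have : dl <= e / 2 by rewrite ge_min lexx orbT.
  by rewrite mul1r; lra.
apply: (he0 e (fun n => H n u) (fun n => phantom u ^+ n) n).
- by rewrite ge_min lexx.
- by apply: hdl'; apply: le_trans Fudl _; rewrite ge_min lexx.
- split => [|k|i j ij|i j].
  + by rewrite expr0.
  + by rewrite exprn_ge0// exprn_ile1.
  + exact: ler_wiXn2l.
  + by rewrite exprD subrr normr0 ltW.
- by rewrite (leq_trans _ n2).
- by apply/andP; split => /=; lra.
- by apply/andP; split => /=; lra.
- by rewrite ler_norml; apply/andP; split => /=; lra.
Qed.

(** To the left of the threshold [x0] both quantities are dominated by their values at [x0], which
    tend to 0 because [F x0] and [phantom x0] are below 1. *)
Lemma phantom_unif t : 0 < t -> exists n0, forall n u, (n0 <= n)%N ->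
  `|H n u - phantom u ^+ n| <= t.
Proof.
move=> t0; have [x0 [Fx0 [Gx0 hx0]]] := phantom_approx t0.
have [n1 hn1] := max_df_cvg0 statX mixX Fx0 t0.
have : (fun n => phantom x0 ^+ n) @ \oo --> (0 : R).
  by apply: cvg_expr; rewrite ger0_norm// phantom_ge0.
move=> /cvgrPdist_le /(_ _ t0) [n2 _ hn2].
exists (maxn n1 n2) => n u; rewrite geq_max => /andP[n1n n2n].
have [xu|xu] := leP x0 u; first exact: hx0.
have h1 := hn1 _ n1n; have /= := hn2 _ n2n.
rewrite sub0r normrN ger0_norm ?exprn_ge0 ?phantom_ge0// => h2.
have h3 : H n u <= H n x0 by apply: joint_df_homo; exact: ltW.
have h4 : phantom u ^+ n <= phantom x0 ^+ n.
  by rewrite lerXn2r ?nnegrE ?phantom_ge0// phantom_homo// ltW.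
have h5 := joint_df_ge0 X (iota 0 n) u.
have h6 : 0 <= phantom u ^+ n by rewrite exprn_ge0// phantom_ge0.
by rewrite ler_norml; apply/andP; split; lra.
Qed.

End phantom.

(** * Conditions on the jumps *)

Section right_end.
Context (R : realType) (F : R -> R).
Implicit Types (x y e : R).

Lemma lt_right_end x : {homo F : x y / x <= y} -> (x%:E < right_end F)%E -> F x < 1.
Proof.
move=> Fh /ereal_sup_gt [_ [y /= Fy <-]]; rewrite lte_fin => /ltW xy.
exact: le_lt_trans (Fh _ _ xy) Fy.
Qed.

Lemma right_end_ge x : F x < 1 -> (x%:E <= right_end F)%E.
Proof. by move=> Fx; apply: ereal_sup_ubound; exists x. Qed.

(** Treats finite and infinite right ends uniformly. *)
Lemma ereal_at_leftP (a : \bar R) (A : set R) : a != -oo%E -> ereal_at_left a A ->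
  exists x0 : R, (x0%:E < a)%E /\ forall x, x0 <= x -> (x%:E < a)%E -> A x.
Proof.
case: a => [r|_|//] //=.
  move=> _ [e /= e0 he]; exists (r - e / 2); split.
    by rewrite lte_fin ltrBlDr ltrDl divr_gt0.
  move=> x xr; rewrite lte_fin => xr'; apply: he => //.
  by rewrite /ball_ /= ger0_norm ?subr_ge0 ?(ltW xr')//; lra.
move=> [M [_ hM]]; exists (M + 1); split; first exact: ltry.
by move=> x Mx _; apply: hM; apply: lt_le_trans Mx; rewrite ltrDl.
Qed.

Lemma jump_left x e : {homo F : x y / x <= y} -> 0 < e ->
  exists y, y < x /\ F x - F y <= jump F x + e.
Proof.
move=> Fh e0; have : cvg (F y @[y --> x^'-]).
  apply: nondecreasing_at_left_is_cvgr.
    by near=> z => a b _ _; exact: Fh.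
  near=> z; exists (F x) => _ [y /= yx <-]; apply: Fh.
  by move: yx; rewrite in_itv /= => /andP[_ /ltW].
move=> /cvgrPdist_le /(_ _ e0) h.
near (x^'-) => y; exists y; split; first by near: y; exact: nbhs_left_lt.
have : `|lim (F y @[y --> x^'-]) - F y| <= e by near: y.
by rewrite /jump ler_norml; lra.
Unshelve. all: by end_near. Qed.

Lemma condition_Delta_bound xi : condition_Delta F xi -> {homo F : x y / x <= y} ->
  exists K : R, 0 < K /\ forall x, (x%:E < right_end F)%E ->
    jump F x <= K * (1 - F x) `^ (1 + xi).
Proof.
rewrite /condition_Delta; set S := [set _ | _ in _] => hS Fh.
have [K hK] : exists K : R, (ereal_sup S <= K%:E)%E.
  case: (ereal_sup S) hS => [r _|//|_]; first by exists r.
  by exists 0; rewrite leNye.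
exists (Num.max K 1); split; first by rewrite lt_max ltr01 orbT.
move=> x xr; have p0 : 0 < (1 - F x) `^ (1 + xi).
  by rewrite powR_gt0// subr_gt0 lt_right_end.
rewrite -ler_pdivrMr// le_max -lee_fin (le_trans _ hK)//.
by apply: ereal_sup_ubound; exists x.
Qed.

End right_end.

(** * Elementary estimates for powers *)

Section powers.
Context (R : realType).
Implicit Types (x e C : R).

Lemma powRN_small C (kappa e : R) : 0 <= C -> 0 < kappa -> 0 < e ->
  exists n0, forall n, (n0 <= n)%N -> C * n%:R `^ (- kappa) <= e.
Proof.
move=> C0 k0 e0; pose z := (C / e) `^ kappa^-1.
exists (Num.truncn z).+1 => n zn.
have zn' : z <= n%:R by apply: ltW; apply: lt_le_trans (truncnS_gt _) _; rewrite ler_nat.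
have n0 : 0 < n%:R `^ kappa :> R by rewrite powR_gt0// ltr0n (leq_trans _ zn).
rewrite powRN ler_pdivrMr// -ler_pdivrMl// mulrC.
have -> : C / e = z `^ kappa by rewrite -powRrM mulVf ?gt_eqF// powRr1// divr_ge0// ltW.
apply: ge0_ler_powR => //; rewrite ?nnegrE//; [exact: ltW|exact: powR_ge0].
Qed.

(** A logarithm-free way to turn a lower bound on [F ^ s] into an upper bound on [s (1 - F)]. *)
Lemma exprn_mulS_le1 (F : R) s : 0 <= F <= 1 -> F ^+ s * (1 + s%:R * (1 - F)) <= 1.
Proof.
move=> /andP[F0 F1]; elim: s => [|s]; first by rewrite mul0r addr0 mulr1.
apply: le_trans; rewrite exprSr -mulrA ler_wpM2l ?exprn_ge0//.
have h : 0 <= s%:R * (1 - F) * (1 - F) by rewrite !mulr_ge0// subr_ge0.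
have := sqr_ge0 (1 - F); rewrite expr2 -natr1; nra.
Qed.

(** With [c = 1 - rho], one has [rho ^ n <= exp(-n c)]; raising [z <= exp z] at [z = n c / beta] to
    the power [beta] yields the constant. *)
Lemma geometric_le_powR (rho beta : R) : 0 <= rho < 1 -> 0 < beta ->
  exists C : R, 0 < C /\ forall n, (0 < n)%N -> rho ^+ n <= C * n%:R `^ (- beta).
Proof.
move=> /andP[rho0 rho1] b0; pose c := 1 - rho; have c0 : 0 < c by rewrite subr_gt0.
exists ((beta / c) `^ beta); split; first by rewrite powR_gt0 ?divr_gt0.
move=> n n0; have n0' : 0 < n%:R :> R by rewrite ltr0n.
have h1 : rho ^+ n <= expR (- (n%:R * c)).
  rewrite -mulrN expRM_natl lerXn2r ?nnegrE ?expR_ge0//.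
  by apply: le_trans (expR_ge1Dx _); rewrite /c; lra.
rewrite powRN ler_pdivlMr ?powR_gt0//.
apply: (@le_trans _ _ (expR (- (n%:R * c)) * n%:R `^ beta)).
  by rewrite ler_wpM2r ?powR_ge0.
rewrite expRN ler_pdivrMl ?expR_gt0//.
pose z := n%:R * c / beta.
have z0 : 0 < z by rewrite divr_gt0// mulr_gt0.
have nz : n%:R = beta / c * z by rewrite /z; field; rewrite !gt_eqF.
have -> : expR (n%:R * c) = expR z `^ beta.
  by rewrite -expRM /z divfK// gt_eqF.
have bc0 : 0 < beta / c by rewrite divr_gt0.
rewrite nz (powRM _ (ltW bc0) (ltW z0)) [leRHS]mulrC ler_wpM2l ?powR_ge0//.
apply: ge0_ler_powR; rewrite ?nnegrE ?expR_ge0 ?ltW//.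
by apply: lt_le_trans (expR_ge1Dx _); rewrite ltrDr.
Qed.

End powers.

(** * From the conditions on [F] to small jumps at the levels *)

Section jumps.
Context d (T : measurableType d) (R : realType) (P : probability T R).
Context (X : nat -> {RV P >-> R}).
Hypothesis statX : stationary X.
Hypothesis mixX : alpha_mixing X.
Hypothesis contX : continuous_at_right_end (marginal_df X).
Implicit Types (x y e : R).

Local Notation F := (marginal_df X).
Local Notation H n x := (joint_df X (iota 0 n) x).
Local Notation q := (expR (-1) : R).

Let F_homo := @marginal_df_homo _ _ _ _ X.

Lemma right_end_neqNy : right_end F != -oo%E.
Proof.
have [x Fx] := marginal_df_left X (@ltr01 R).
by apply: contraTneq (right_end_ge Fx) => ->; rewrite leeNy_eq.
Qed.

Lemma marginal_df_near1 e : 0 < e -> exists x, 1 - e < F x < 1.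
Proof.
move=> e0; have h : ereal_at_left (right_end F) (F @^-1` ball (1 : R) e).
  exact: contX (nbhsx_ballx (1 : R) _ e0).
have [x [xr hx]] := ereal_at_leftP right_end_neqNy h.
exists x; rewrite (lt_right_end _ xr) // andbT.
have : ball (1 : R) e (F x) by exact: hx.
by rewrite /ball /= ltr_norml; lra.
Qed.

Lemma marginal_lt1_right_end x : F x < 1 -> (x%:E < right_end F)%E.
Proof.
move=> Fx; have Fx' : 0 < 1 - F x by rewrite subr_gt0.
have [y /andP[xy y1]] := marginal_df_near1 Fx'.
apply: lt_le_trans (right_end_ge y1); rewrite lte_fin ltNge; apply/negP => /F_homo.
lra.
Qed.

(** With [s = n %/ r] the mixing error [4 s a] is at most 1/8, so [F x ^ s >= q - 1/8 >= 1/8] and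
    [s (1 - F x) <= 8]; finally [n <= 2 r s]. *)
Lemma max_df_tail_bound r (a : R) n x : 0 <= a -> (alpha_coef X r <= a%:E)%E ->
  (0 < r)%N -> (r <= n)%N -> 32 * (n %/ r)%:R * a <= 1 -> q <= H n x ->
  n%:R * (1 - F x) <= 16 * r%:R.
Proof.
move=> a0 ra r0 rn sa qH; set s := (n %/ r)%N.
have s1 : 1 <= s%:R :> R by rewrite ler1n divn_gt0.
have rs : (r * s <= n)%N by rewrite mulnC leq_divM.
have [q4 _] := andP (expRN1_bounds R).
have F0 := marginal_df_ge0 X x; have F1 := marginal_df_le1 X x.
have h : F x ^+ s * (1 + s%:R * (1 - F x)) <= 1 by apply: exprn_mulS_le1; rewrite F0.
have Fs : 8^-1 <= F x ^+ s.
  by have := max_df_le_exp statX x a0 ra r0 rs; rewrite -/s in sa; lra.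
have sF0 : 0 <= s%:R * (1 - F x) by rewrite mulr_ge0// subr_ge0.
have sF : s%:R * (1 - F x) <= 8.
  have := ler_wpM2r (addr_ge0 ler01 sF0) Fs; lra.
have ns : n%:R <= 2 * r%:R * s%:R :> R.
  have : (n <= s.+1 * r)%N by rewrite ltnW// ltn_ceil.
  rewrite -(ler_nat R) natrM -natr1 => /le_trans; apply.
  by rewrite mulrC mulrAC [leRHS]mulrC ler_wpM2l//; lra.
have F1' : 0 <= 1 - F x by rewrite subr_ge0.
have := ler_wpM2r F1' ns.
have := ler_wpM2l (ler0n R r) sF.
nra.
Qed.

Lemma small_jumps_of_bound :
  (forall e, 0 < e -> exists n0, forall n x, (n0 <= n)%N -> F x < 1 ->
    q <= H n x -> n%:R * jump F x <= e) -> small_jumps X.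
Proof.
move=> hyp e e0; have e2 : 0 < e / 2 by rewrite divr_gt0.
have [n0 hn0] := hyp _ e2; exists n0.+1 => n x nn Fx qx.
have n0' : 0 < n%:R :> R by rewrite ltr0n (leq_trans _ nn).
have [y [yx hy]] := jump_left x F_homo (divr_gt0 e2 n0').
exists y; split => //; have := hn0 _ _ (ltnW nn) Fx qx.
have := ler_wpM2l (ltW n0') hy; rewrite [leRHS]mulrDr
  [X in _ <= _ + X]mulrC divfK ?gt_eqF//; lra.
Qed.

Lemma small_jumps_m_dependent m : alpha_coef X m.+1 = 0%E -> condition_Delta0 F ->
  small_jumps X.
Proof.
move=> am D0; apply: small_jumps_of_bound => e e0.
have r0 : 0 < 16 * m.+1%:R :> R by rewrite mulr_gt0.
pose c := e / (16 * m.+1%:R); have c0 : 0 < c by rewrite divr_gt0.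
have h : ereal_at_left (right_end F)
    ((fun x => jump F x / (1 - F x)) @^-1` ball (0 : R) c).
  exact: D0 (nbhsx_ballx (0 : R) _ c0).
have [x0 [xr hx]] := ereal_at_leftP right_end_neqNy h.
have Fx0 := lt_right_end F_homo xr.
(* Requiring [1 - F x] to be at most half of [1 - F x0] forces [x >= x0]. *)
have Fx0' : 0 < (1 - F x0) / 2 by rewrite divr_gt0 ?subr_gt0.
have [n1 hn1] := max_df_unif statX mixX marginal_df_near1 Fx0'.
exists (maxn m.+1 n1) => n x; rewrite geq_max => /andP[mn nn] Fx qx.
have x0x : x0 <= x.
  by rewrite leNgt; apply/negP => /ltW /F_homo; have := hn1 _ _ nn qx; lra.
have : ball (0 : R) c (jump F x / (1 - F x)).
  by apply: hx => //; exact: marginal_lt1_right_end.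
rewrite /ball /= sub0r normrN => /ltW /(le_trans (ler_norm _)).
rewrite ler_pdivrMr ?subr_gt0// => hj.
have hb : n%:R * (1 - F x) <= 16 * m.+1%:R.
  by apply: (@max_df_tail_bound m.+1 0) => //; rewrite am.
have := ler_wpM2l (ler0n R n) hj; have := ler_wpM2l (ltW c0) hb.
have : c * (16 * m.+1%:R) = e by rewrite /c divfK// gt_eqF.
lra.
Qed.

Lemma small_jumps_polynomial (C beta xi : R) : 0 < C -> 0 < beta -> beta^-1 < xi ->
  (forall n, (0 < n)%N -> (alpha_coef X n <= (C * n%:R `^ (- beta))%:E)%E) ->
  condition_Delta F xi -> small_jumps X.
Proof.
move=> C0 b0 bx ha D; apply: small_jumps_of_bound => e e0.
have x0 : 0 < xi by apply: lt_trans bx; rewrite invr_gt0.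
have xib : 1 < xi * beta by rewrite -ltr_pdivrMr// mul1r.
have [K [K0 hK]] := condition_Delta_bound D F_homo.
(* With gap [n ^ theta] the mixing error is of order [n ^ (1 - theta - theta beta)], which must
   vanish. Then [1 - F x] is of order [n ^ (theta - 1)], and [n jump] of order
   [n ^ (1 + (theta - 1) (1 + xi))], which must vanish too. The midpoint works because [1 < xi beta]
   makes the range of exponents nonempty. *)
have [theta [t0 [t1 [tb tx]]]] : exists theta : R, 0 < theta /\ theta < 1 /\
    1 < theta * (1 + beta) /\ theta * (1 + xi) < xi.
  pose u := (1 + beta)^-1; pose w := xi / (1 + xi).
  have u0 : 0 < u by rewrite invr_gt0 addr_gt0.
  have x1 : 0 < 1 + xi by rewrite addr_gt0.
  have w1 : w < 1 by rewrite ltr_pdivrMr// mul1r ltrDr.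
  have uw : u < w.
    by rewrite /u /w ltr_pdivlMr// mulrC ltr_pdivrMr ?addr_gt0//; lra.
  exists ((u + w) / 2); split; first lra; split; first lra.
  have h1 : u * (1 + beta) = 1 by rewrite mulVf// gt_eqF// addr_gt0.
  have h2 : w * (1 + xi) = xi by rewrite divfK// gt_eqF.
  have h3 : u * (1 + beta) < w * (1 + beta) by rewrite ltr_pM2r// addr_gt0.
  have h4 : u * (1 + xi) < w * (1 + xi) by rewrite ltr_pM2r.
  split; lra.
pose rr n := (Num.truncn (n%:R `^ theta : R)).+1.
pose K' := K * 32 `^ (1 + xi).
have K'0 : 0 <= K' by rewrite mulr_ge0 ?powR_ge0// ltW.
have C32 : 0 <= 32 * C by rewrite mulr_ge0// ltW.
have p1 : 0 < 1 - theta by rewrite subr_gt0.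
have p2 : 0 < theta * (1 + beta) - 1 by rewrite subr_gt0.
have p3 : 0 < xi - theta * (1 + xi) by rewrite subr_gt0.
have [n1 hn1] := powRN_small (ler0n R 2) p1 ltr01.
have [n2 hn2] := powRN_small C32 p2 ltr01.
have [n3 hn3] := powRN_small K'0 p3 e0.
exists (maxn 1 (maxn n1 (maxn n2 n3))) => n x.
rewrite !geq_max => /and4P[n0 nn1 nn2 nn3] Fx qx.
have n0' : 0 < n%:R :> R by rewrite ltr0n.
have nD (u v : R) : n%:R `^ (u + v) = n%:R `^ u * n%:R `^ v :> R.
  by rewrite powRD// (gt_eqF n0') implybT.
have nt1 : 1 <= n%:R `^ theta :> R.
  apply: (@le_trans _ _ (1 `^ theta)); first by rewrite powR1.
  by apply: ge0_ler_powR; rewrite ?nnegrE ?ler1n ?ltW.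
have r1 : n%:R `^ theta <= (rr n)%:R :> R by rewrite ltW// truncnS_gt.
have r2 : (rr n)%:R <= 2 * n%:R `^ theta :> R.
  rewrite /rr -[leLHS]natr1.
  have : (Num.truncn (n%:R `^ theta : R))%:R <= n%:R `^ theta :> R.
    by rewrite truncn_le powR_ge0.
  lra.
have r0 : (0 < rr n)%N by [].
have r0' : 0 < (rr n)%:R :> R by rewrite ltr0n.
have rn : (rr n <= n)%N.
  rewrite -(ler_nat R); apply: (le_trans r2).
  have -> : n%:R `^ theta = n%:R `^ (- (1 - theta)) * n%:R :> R.
    by rewrite -[X in _ * X]powRr1// -nD; congr (_ `^ _); ring.
  by have := ler_wpM2r (ltW n0') (hn1 _ nn1); rewrite mul1r -mulrA.
have sn : (n %/ rr n)%:R <= n%:R `^ (1 - theta) :> R.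
  rewrite nD powRr1// powRN ler_pdivlMr ?powR_gt0//.
  apply: (@le_trans _ _ ((n %/ rr n)%:R * (rr n)%:R)); first by rewrite ler_wpM2l.
  by rewrite -natrM ler_nat leq_divM.
have hb : n%:R * (1 - F x) <= 16 * (rr n)%:R.
  pose a := C * (rr n)%:R `^ (- beta).
  apply: (@max_df_tail_bound _ a) => //.
  - by rewrite mulr_ge0 ?powR_ge0// ltW.
  - exact: ha.
  apply: le_trans (hn2 _ nn2).
  have h1 : (rr n)%:R `^ (- beta) <= n%:R `^ (- (theta * beta)) :> R.
    rewrite !powRN lef_pV2 ?posrE ?powR_gt0// powRrM.
    by apply: ge0_ler_powR; rewrite ?nnegrE ?powR_ge0 ?ler0n ?(ltW b0).
  have -> : - (theta * (1 + beta) - 1) = (1 - theta) + - (theta * beta) by ring.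
  rewrite nD /a -!mulrA [leLHS](_ : _ =
    32 * C * ((n %/ rr n)%:R * (rr n)%:R `^ (- beta))); last by ring.
  by rewrite !mulrA -!(mulrA (32 * C)) ler_wpM2l// ler_pM ?powR_ge0.
have F1n : 1 - F x <= 32 * n%:R `^ (theta - 1).
  rewrite nD powRN powRr1// mulrA ler_pdivlMr// mulrC; lra.
apply: (le_trans _ (hn3 _ nn3)).
apply: (le_trans (ler_wpM2l (ltW n0') (hK _ (marginal_lt1_right_end Fx)))).
rewrite /K' mulrCA -mulrA ler_wpM2l ?(ltW K0)//.
have -> : - (xi - theta * (1 + xi)) = 1 + (theta - 1) * (1 + xi) by ring.
rewrite nD powRr1// mulrCA ler_wpM2l ?(ltW n0')//.
rewrite powRrM -powRM ?powR_ge0//.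
by apply: ge0_ler_powR; rewrite ?nnegrE ?mulr_ge0 ?powR_ge0//; lra.
Qed.

End jumps.

(** * The theorem *)

Lemma phantom_df_of_unif d (T : measurableType d) (R : realType)
    (P : probability T R) (X : nat -> {RV P >-> R}) (G : R -> R) :
  (forall t, 0 < t -> exists n0, forall n u, (n0 <= n)%N ->
    `|joint_df X (iota 0 n) u - G u ^+ n| <= t) -> phantom_df X G.
Proof.
move=> hG; apply/fine_cvgP.
have bound t : 0 < t -> exists n0, forall n, (n0 <= n)%N ->
    (0 <= ereal_sup [set `|P [set w | (running_max X n w <= u)%R]
       - (G u ^+ n)%:E|%E | u in [set: R]] <= t%:E)%E.
  (* The successor excludes [n = 0], where [running_max] is only its default value. *)
  move=> t0; have [n0 hn0] := hG t t0; exists n0.+1 => n nn.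
  have n1 : (0 < n)%N by exact: leq_ltn_trans nn.
  apply/andP; split.
    apply: le_trans (ereal_sup_ubound _); last by exists 0.
    exact: abse_ge0.
  apply: ge_ereal_sup => _ [u _ <-].
  by rewrite running_max_df// lee_fin; exact: hn0 (ltnW nn).
have fin (z : \bar R) t : (0 <= z <= t%:E)%E -> z \is a fin_num.
  by move=> /andP[z0 zt]; rewrite ge0_fin_numE// (le_lt_trans zt)// ltry.
split.
  have [n0 hn0] := bound _ ltr01; exists n0 => // n /= nn.
  exact: fin (hn0 _ nn).
apply/cvgrPdist_le => t t0; have [n0 hn0] := bound _ t0.
exists n0 => // n /= nn; have h := hn0 _ nn; have f := fin _ _ h.
move: h; rewrite -(fineK f) !lee_fin => /andP[h0 ht].
by rewrite sub0r normrN /= ger0_norm.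
Qed.

Lemma cumulativeBounded_of_continuous (R : realType) (G : R -> R) :
  {homo G : x y / x <= y} -> continuous G ->
  G @ -oo --> (0 : R) -> G @ +oo --> (1 : R) ->
  exists G' : cumulativeBounded (0 : R) (1 : R), G' = G :> (R -> R).
Proof.
move=> Gh Gc GN Gy.
pose m1 := isCumulative.Build R _ R G Gh (right_continuousW Gc).
pose m2 := isCumulativeBounded.Build R 0 1 G GN Gy.
pose G' : cumulativeBounded (0 : R) (1 : R) := HB.pack G m1 m2.
by exists G'.
Qed.

Theorem theorem4p11 (d : measure_display) (T : measurableType d)
    (R : realType) (P : probability T R) (X : nat -> {RV P >-> R}) :
  stationary X ->
  alpha_mixing X ->
  continuous_at_right_end (marginal_df X) ->
  [\/ (exists m : nat, alpha_coef X m.+1 = 0%E) /\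
        condition_Delta0 (marginal_df X),
      (exists C rho : R, [/\ 0 < C, 0 <= rho, rho < 1 &
          forall n : nat, (0 < n)%N -> (alpha_coef X n <= (C * rho ^+ n)%:E)%E])
        /\ (exists xi : R, 0 < xi /\ condition_Delta (marginal_df X) xi)
    | exists C beta : R, [/\ 0 < C, 0 < beta,
          forall n : nat, (0 < n)%N ->
            (alpha_coef X n <= (C * n%:R `^ (- beta))%:E)%E &
          exists xi : R, beta^-1 < xi /\ condition_Delta (marginal_df X) xi]] ->
  exists G : cumulativeBounded (0 : R) (1 : R), continuous G /\ phantom_df X G.
Proof.
move=> statX mixX contX cases.
have jumpsX : small_jumps X.
  case: cases => [[[m am] D0]|[[C [rho [C0 rho0 rho1 ha]]] [xi [xi0 D]]]|].
  - exact: small_jumps_m_dependent am D0.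
  (* Geometric decay allows any polynomial rate; [beta = 2 / xi] gives [beta^-1 = xi / 2 < xi]. *)
  - have b0 : 0 < 2 / xi by rewrite divr_gt0.
    have [|C' [C'0 hC']] := @geometric_le_powR _ rho _ _ b0; first by rewrite rho0.
    apply: (@small_jumps_polynomial _ _ _ _ _ statX contX (C * C') _ xi _ b0) => //.
    + exact: mulr_gt0.
    + by rewrite invf_div ltr_pdivrMr// ltr_pMr// ltr1n.
    + move=> n n0; apply: le_trans (ha n n0) _.
      by rewrite lee_fin -mulrA ler_wpM2l ?(ltW C0)// hC'.
  - by move=> [C [beta [C0 b0 ha [xi [bx D]]]]]; exact: small_jumps_polynomial ha D.
have near1 := marginal_df_near1 contX.
have [G GE] := cumulativeBounded_of_continuous
  (@phantom_homo _ _ _ _ X) (@continuous_phantom _ _ _ _ X)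
  (phantom_cvgNy statX near1) (@phantom_cvgy _ _ _ _ X).
exists G; rewrite GE; split; first exact: continuous_phantom.
by apply: phantom_df_of_unif => t; exact: phantom_unif.
Qed.
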